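(* Let $G=(V,E)$ be a poset and $p$ a distribution over $V$. Assign to every edge $(u,v)$ of the transitive closure $TC(G)$ the weight $\max(0,p(u)-p(v))$, and let $W$ be the weight of a maximum weighted matching in $TC(G)$. Then the total variation distance of $p$ to the set of monotone distributions on $G$ is within a factor of two of $W$.
   Context: A poset is represented by a directed graph $G=(V,E)$, where an edge $(u,v)$ means $u\preceq v$. A distribution $p$ on $V$ is monotone if $p(u)\le p(v)$ for every $(u,v)\in E$. The transitive closure $TC(G)$ contains an edge $(u,v)$ whenever there is a directed path from $u$ to $v$ in $G$. A matching is a set of vertex-disjoint edges; its weight is the sum of its edge weights. *)

(* Defs.v *)
From mathcomp Require Import all_boot all_order all_algebra.
From mathcomp Require Import all_classical all_reals.

Set Implicit Arguments.
Unset Strict Implicit.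
Unset Printing Implicit Defensive.

Import Order.TTheory GRing.Theory Num.Theory.
Local Open Scope ring_scope.

(* A digraph [e] on the finite vertex set [V] represents a poset when
   reachability is antisymmetric: [e] has no directed cycle through two
   distinct vertices. Loops of [e] are allowed, as [e u v] reads u <= v. *)
Definition represents_poset (V : finType) (e : rel V) : Prop :=
  antisymmetric (connect e).

(* Directed paths of length at least one; [connect e] alone is reflexive. *)
Definition transitive_closure (V : finType) (e : rel V) : rel V :=
  fun u v => [exists w, e u w && connect e w v].

Definition distribution (R : realType) (V : finType) (p : V -> R) : Prop :=
  (forall v, 0 <= p v) /\ \sum_(v : V) p v = 1.

Definition monotone (R : realType) (V : finType) (e : rel V) (p : V -> R)
  : Prop :=
  forall u v, e u v -> p u <= p v.

Definition tv_dist (R : realType) (V : finType) (p q : V -> R) : R :=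
  2^-1 * \sum_(v : V) `|p v - q v|.

Definition monotone_distributions (R : realType) (V : finType) (e : rel V)
  : set (V -> R) :=
  [set q | distribution q /\ monotone e q]%classic.

Definition tv_dist_to_monotone (R : realType) (V : finType) (e : rel V)
    (p : V -> R) : R :=
  inf [set tv_dist p q | q in @monotone_distributions R V e]%classic.

Definition ends (V : finType) (a : V * V) : {set V} := [set a.1; a.2]%SET.

Definition is_matching (V : finType) (e : rel V) (M : {set V * V}) : bool :=
  [forall a in M, e a.1 a.2] &&
  [forall a in M, forall b in M, (a != b) ==> [disjoint ends a & ends b]].

Definition edge_weight (R : realType) (V : finType) (p : V -> R) (a : V * V)
  : R :=
  Num.max 0 (p a.1 - p a.2).

Definition matching_weight (R : realType) (V : finType) (p : V -> R)
    (M : {set V * V}) : R :=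
  \sum_(a in M) edge_weight p a.

(* Weights are nonnegative and the empty set is a matching of weight 0, so the
   default value 0 does not affect the maximum. *)
Definition max_matching_weight (R : realType) (V : finType) (e : rel V)
    (p : V -> R) : R :=
  \big[Num.max/0]_(M : {set V * V} | is_matching e M) matching_weight p M.

Definition within_factor (R : realType) (c x y : R) : Prop :=
  y / c <= x /\ x <= c * y.

(* Main.v *)
Require Import Defs.
From mathcomp Require Import all_boot all_order all_algebra.
From mathcomp Require Import all_classical all_reals.
From mathcomp Require Import lra.

Local Open Scope ring_scope.

(** If [q] is monotone, an edge of [TC(G)] violated by [p] costs [q] at least its
    weight at its two ends, which gives the lower bound. For the upper bound,
    let [c v] be the weight of the edge at [v] in a maximum weight matching
    [M]. Exchanging an edge [(u, v)] against the edges of [M] that it meets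
    shows that its weight is at most [c u + c v], so that
    [f v := max (0, max_(u <= v) (p u - c u))] is a monotone function with
    [|p - f| <= c], while [c] has total mass twice the weight of [M].
    Normalizing [f] to a distribution at most doubles its distance to [p]. *)

Import Order.TTheory GRing.Theory Num.Theory.

Set Implicit Arguments.
Unset Strict Implicit.
Unset Printing Implicit Defensive.

Section Matching.
Variables (R : realType) (V : finType).
Implicit Types (t : rel V) (p : V -> R) (M : {set V * V}) (a b : V * V).

(** If [M] is a matching, at most one edge contributes, so this is the weight of the edge of [M] at
    [v], or 0 if there is none. *)
Definition vertex_load p M (v : V) : R :=
  \sum_(b in M | v \in ends b) edge_weight p b.

Lemma edge_weight_ge0 p a : 0 <= edge_weight p a.
Proof. by rewrite /edge_weight le_max lexx. Qed.

Lemma edge_weight_loop p v : edge_weight p (v, v) = 0.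
Proof. by rewrite /edge_weight /= subrr maxxx. Qed.

Lemma vertex_load_ge0 p M v : 0 <= vertex_load p M v.
Proof. by apply: sumr_ge0 => b _; exact: edge_weight_ge0. Qed.

Lemma matchingP t M :
  reflect ((forall a, a \in M -> t a.1 a.2) /\
           (forall a b, a \in M -> b \in M -> a != b ->
              [disjoint ends a & ends b]))
          (is_matching t M).
Proof.
apply: (iffP andP) => -[H1 H2]; split.
- by move=> a aM; exact: (forall_inP H1).
- by move=> a b aM bM; apply/implyP; exact: (forall_inP (forall_inP H2 a aM)).
- by apply/forall_inP.
- by apply/forall_inP => a aM; apply/forall_inP => b bM; apply/implyP; exact: H2.
Qed.

Lemma matching0 t : is_matching t finset.set0.
Proof. by apply/matchingP; split=> [a|a b]; rewrite inE. Qed.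

Lemma matching_exchange t M a : is_matching t M -> t a.1 a.2 ->
  is_matching t (a |: [set b in M | [disjoint ends a & ends b]])%SET.
Proof.
move=> /matchingP[tM dM] ta; apply/matchingP; split=> [b|b d].
  by rewrite !inE => /orP[/eqP-> //|/andP[/tM]].
rewrite !inE => /orP[/eqP->|/andP[bM ab]] /orP[/eqP->|/andP[dM' ad]].
- by rewrite eqxx.
- by [].
- by rewrite disjoint_sym.
- exact: dM.
Qed.

Lemma sum_ends (g : V -> R) a :
  a.1 != a.2 -> \sum_(v in ends a) g v = g a.1 + g a.2.
Proof. by move=> ne; rewrite /ends big_setU1 ?inE //= big_set1. Qed.

(** After exchanging the sums, each [g v] is counted at most once, since disjoint edges cannot share
    [v]. *)
Lemma sum_ends_le (g : V -> R) M :
  (forall v, 0 <= g v) ->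
  (forall a b, a \in M -> b \in M -> a != b -> [disjoint ends a & ends b]) ->
  \sum_(a in M) \sum_(v in ends a) g v <= \sum_v g v.
Proof.
move=> g0 dM.
rewrite (eq_bigr (fun a => \sum_v if v \in ends a then g v else 0)); last first.
  by move=> a _; rewrite -big_mkcond.
rewrite exchange_big /=; apply: ler_sum => v _.
case: (pickP [pred a | (a \in M) && (v \in ends a)]) => [a /andP[aM va]|none].
  rewrite (bigD1 a) //= va big1 ?addr0 // => b /andP[bM ba].
  by rewrite (disjointFl (dM _ _ bM aM ba) va).
by rewrite big1 // => a aM; have := none a; rewrite /= aM /= => ->.
Qed.

Lemma sum_vertex_load p M :
  \sum_v vertex_load p M v <= 2 * matching_weight p M.
Proof.
rewrite /vertex_load.
rewrite (eq_bigr (fun v => \sum_(b in M) if v \in ends b then edge_weight p b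
  else 0)); last by move=> v _; rewrite big_mkcondr.
rewrite exchange_big /= /matching_weight mulr_sumr; apply: ler_sum => -[u v] _.
(* A loop has one end rather than two, but its weight is 0. *)
rewrite -big_mkcond /=; case: (eqVneq u v) => [->|ne].
  by rewrite edge_weight_loop big1 // mulr0.
by rewrite sum_ends //= mulr_natl mulr2n.
Qed.

Lemma max_matching_load p t M :
  is_matching t M ->
  (forall N, is_matching t N -> matching_weight p N <= matching_weight p M) ->
  forall u v, t u v -> p u - p v <= vertex_load p M u + vertex_load p M v.
Proof.
move=> mM maxM u v tuv; set a := (u, v).
suff: edge_weight p a <= vertex_load p M u + vertex_load p M v.
  by apply: le_trans; rewrite /edge_weight le_max lexx orbT.
have := maxM _ (matching_exchange (a := a) mM tuv).
set N := [set b in M | _]%SET => leN.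
have split_M : matching_weight p M = matching_weight p N +
    \sum_(b in M | ~~ [disjoint ends a & ends b]) edge_weight p b.
  rewrite /matching_weight (bigID (fun b => [disjoint ends a & ends b])) /=.
  by congr (_ + _); apply: eq_bigl => b; rewrite !inE.
(* Even if [a] lies in [M], it meets itself and so is among the removed edges. *)
have aN : a \notin N.
  by rewrite !inE negb_and -finset.setI_eq0 finset.setIid; apply/orP; right;
     apply/finset.set0Pn; exists u; rewrite !inE eqxx.
have split_N : matching_weight p (a |: N)%SET =
    edge_weight p a + matching_weight p N.
  by rewrite /matching_weight big_setU1.
(* Every removed edge contains [u] or [v]; one containing both is counted twice on the right, which
   is harmless as weights are nonnegative. *)
have le_loads : \sum_(b in M | ~~ [disjoint ends a & ends b]) edge_weight p b
    <= vertex_load p M u + vertex_load p M v.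
  rewrite /vertex_load !big_mkcondr -big_split /=; apply: ler_sum => b _.
  have w0 := edge_weight_ge0 p b.
  have -> : [disjoint ends a & ends b] =
      (u \notin ends b) && (v \notin ends b).
    rewrite -finset.setI_eq0 finset.setIUl finset.setU_eq0.
    by rewrite !finset.setI_eq0 !disjoints1.
  by case: (u \in _); case: (v \in _); rewrite /= ?addr0 ?add0r // lerDl.
lra.
Qed.

End Matching.

Section MonotoneApproximation.
Variables (R : realType) (V : finType) (e : rel V).
Implicit Types (p q f c : V -> R).

Lemma connect_transitive_closure u v :
  connect e u v -> u = v \/ transitive_closure e u v.
Proof.
case/connectP => -[|w s] /= => [_ ->|/andP[uw ws] ->]; first by left.
by right; apply/existsP; exists w; rewrite uw; apply/connectP; exists s.
Qed.

Lemma monotone_transitive_closure q u v :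
  monotone e q -> transitive_closure e u v -> q u <= q v.
Proof.
move=> mq /existsP[w /andP[/mq uw /connectP[s ws ->]]].
apply: le_trans uw _; elim: s w ws => //= x s IH w /andP[/mq wx /IH].
exact: le_trans.
Qed.

(** As [q u <= q v], an edge weighs at most [|p u - q u| + |p v - q v|]. Disjointness lets these
    bounds add up to at most the L1 distance. *)
Lemma matching_weight_le_tv p q M :
  monotone e q -> is_matching (transitive_closure e) M ->
  matching_weight p M <= 2 * tv_dist p q.
Proof.
move=> mq /matchingP[tM dM].
rewrite /tv_dist mulrA divff ?mul1r ?pnatr_eq0 //.
apply: le_trans (sum_ends_le (g := fun v => `|p v - q v|) _ dM) => //.
apply: ler_sum => -[u v] /tM /= /(monotone_transitive_closure mq) quv.
have [->|ne] := eqVneq u v.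
  by rewrite edge_weight_loop sumr_ge0.
rewrite sum_ends //= /edge_weight ge_max addr_ge0 //=.
have := ler_norm (p u - q u); have := ler_norm (- (p v - q v)).
rewrite normrN; lra.
Qed.

(** The least nonnegative monotone function above [p - c]. *)
Definition monotone_hull p c (v : V) : R :=
  \big[Num.max/0]_(u | connect e u v) (p u - c u).

Lemma monotone_hull_ge0 p c v : 0 <= monotone_hull p c v.
Proof. exact: bigmax_ge_id. Qed.

Lemma monotone_hull_monotone p c : monotone e (monotone_hull p c).
Proof.
move=> u v uv; apply: bigmax_le => [|w wu]; first exact: monotone_hull_ge0.
apply: (le_bigmax_cond _ (fun u => p u - c u)).
exact: connect_trans wu (connect1 uv).
Qed.

(** The term [u = v] of the maximum gives the lower bound; the hypothesis on [p u - p v],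
    rearranged, bounds the other terms by [p v + c v]. *)
Lemma monotone_hull_close p c :
  (forall v, 0 <= p v) -> (forall v, 0 <= c v) ->
  (forall u v, transitive_closure e u v -> p u - p v <= c u + c v) ->
  forall v, `|p v - monotone_hull p c v| <= c v.
Proof.
move=> p0 c0 cover v.
have lo : p v - c v <= monotone_hull p c v.
  exact: (le_bigmax_cond _ (fun u => p u - c u)).
have up : monotone_hull p c v <= p v + c v.
  apply: bigmax_le => [|u /connect_transitive_closure[->|/cover]].
  - exact: addr_ge0.
  - by have := c0 v; lra.
  - lra.
by rewrite ler_norml; apply/andP; split; lra.
Qed.

(** Scaling moves all values of [f] in the same direction, so [f] and [f / S] are at L1 distance
    [|1 - S|], the absolute value of the sum of [p - f]. The triangle inequality concludes. *)
Lemma normalize_dist p f (S := \sum_v f v) :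
  \sum_v p v = 1 -> (forall v, 0 <= f v) -> 0 < S ->
  \sum_v `|p v - f v / S| <= 2 * \sum_v `|p v - f v|.
Proof.
move=> sum_p f0 S0.
have near_f : \sum_v `|f v - f v / S| <= \sum_v `|p v - f v|.
  have -> : \sum_v `|f v - f v / S| = `|\sum_v (p v - f v)|.
    rewrite sumrB sum_p -/S.
    rewrite (eq_bigr (fun v => f v * `|1 - S^-1|)) => [|v _]; last first.
      by rewrite -{1}[f v]mulr1 -mulrBr normrM ger0_norm.
    rewrite -mulr_suml -/S -{1}(gtr0_norm S0) -normrM mulrBr mulr1.
    by rewrite divff ?gt_eqF // distrC.
  exact: ler_norm_sum.
rewrite mulr_natl mulr2n; apply: le_trans (lerD (lexx _) near_f).
by rewrite -big_split; apply: ler_sum => v _; exact: ler_distD.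
Qed.

Lemma tv_dist_le1 p q : distribution p -> distribution q -> tv_dist p q <= 1.
Proof.
move=> [p0 sum_p] [q0 sum_q]; rewrite /tv_dist.
suff : \sum_v `|p v - q v| <= \sum_v p v + \sum_v q v.
  by rewrite sum_p sum_q; lra.
rewrite -big_split; apply: ler_sum => v _ /=.
by apply: le_trans (ler_normB _ _) _; rewrite !ger0_norm.
Qed.

Lemma uniform_monotone_distribution p :
  distribution p -> monotone_distributions e (fun _ => #|V|%:R^-1 : R).
Proof.
move=> [_ sum_p]; split; last by [].
split=> [v|]; first by rewrite invr_ge0.
(* [V] is nonempty because [p] has total mass 1. *)
rewrite sumr_const -[_ *+ _]mulr_natl divff // pnatr_eq0; apply/eqP => V0.
move: sum_p; rewrite big1 => [/eqP|v _]; first by rewrite eq_sym oner_eq0.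
by have := fintype0 v V0.
Qed.

Lemma close_monotone_distribution p f :
  distribution p -> (forall v, 0 <= f v) -> monotone e f ->
  exists2 q, monotone_distributions e q &
    tv_dist p q <= \sum_v `|p v - f v|.
Proof.
move=> dp f0 mf; have [p0 sum_p] := dp.
have S_ge0 : 0 <= \sum_v f v by apply: sumr_ge0.
have [S0|S_neq0] := eqVneq (\sum_v f v) 0.
  (* A zero [f] cannot be normalized, but then the right side is at least 1, which bounds every
     total variation distance. *)
  exists (fun _ => #|V|%:R^-1); first exact: uniform_monotone_distribution dp.
  apply: le_trans (tv_dist_le1 dp _) _.
    by have [] := uniform_monotone_distribution dp.
  apply: le_trans (ler_norm_sum _ _ _).
  by rewrite sumrB S0 sum_p subr0 normr1.
have S_gt0 : 0 < \sum_v f v by rewrite lt_def S_neq0.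
exists (fun v => f v / \sum_v f v).
  split; first split.
  - by move=> v; rewrite divr_ge0.
  - by rewrite -mulr_suml divff.
  - by move=> u v /mf uv; rewrite ler_pM2r // invr_gt0.
(* The factor 2 lost by normalizing cancels the one half in [tv_dist]. *)
by rewrite /tv_dist; have := normalize_dist sum_p f0 S_gt0; lra.
Qed.

End MonotoneApproximation.

Theorem theorem3 (R : realType) (V : finType) (e : rel V) (p : V -> R)
    (poset_e : represents_poset e) (dist_p : distribution p) :
  within_factor 2 (tv_dist_to_monotone e p)
    (max_matching_weight (transitive_closure e) p).
Proof.
split.
  apply: lb_le_inf.
    exists (tv_dist p (fun _ => #|V|%:R^-1)); apply: imageP.
    exact: uniform_monotone_distribution dist_p.
  move=> _ [q [_ mq] <-]; rewrite ler_pdivrMr // mulrC.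
  apply: bigmax_le => [|M mM]; last first.
    exact: matching_weight_le_tv mq mM.
  (* The default value 0 is the weight of the empty matching. *)
  apply: le_trans (matching_weight_le_tv p mq (matching0 _)).
  by rewrite /matching_weight big_set0.
have [M mM maxM] := arg_maxP (matching_weight p)
  (matching0 (transitive_closure e)).
have W_ge : matching_weight p M <= max_matching_weight (transitive_closure e) p.
  exact: (le_bigmax_cond _ (matching_weight p)).
have [p0 _] := dist_p.
have close := monotone_hull_close p0 (vertex_load_ge0 p M)
  (max_matching_load mM maxM).
have [q mq le_q] := close_monotone_distribution dist_p
  (monotone_hull_ge0 e p (vertex_load p M))
  (@monotone_hull_monotone _ _ e p (vertex_load p M)).
apply: (@le_trans _ _ (tv_dist p q)).
  apply: ge_inf; last exact: imageP.
  by exists 0 => _ [r _ <-]; rewrite /tv_dist mulr_ge0 ?invr_ge0 ?sumr_ge0.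
(* The distance is at most the total load, hence at most twice the weight of [M]. *)
apply: le_trans le_q _; apply: le_trans (ler_sum _ (fun v _ => close v)) _.
by apply: le_trans (sum_vertex_load p M) _; rewrite ler_pM2l.
Qed.
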